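(* Let $m,k$ be positive integers with $\gcd(k,m)=1$, let $K=\mathbb{F}_{2^m}$, let $\sigma\colon K\to K$, $x\mapsto x^{2^k}$, and let $\alpha\in K$ be such that $X^{\sigma+1}+X+\alpha$ has no root in $K$. Then $F_{\alpha,\sigma}\colon K^2\to K^2$ is $3$-to-$1$ and has classical Walsh spectrum.
   Context: For $K=\mathbb{F}_{2^m}$, a field automorphism $\sigma\colon x\mapsto x^{2^k}$ of $K$ with $\gcd(k,m)=1$, and $\alpha\in K$, define $F_{\alpha,\sigma}\colon K^2\to K^2$ by $F_{\alpha,\sigma}=(f_{\alpha,\sigma},g_{\alpha,\sigma})$ with $$f_{\alpha,\sigma}(x,y)=x^{\sigma+1}+xy^\sigma+\alpha y^{\sigma+1},$$ $$g_{\alpha,\sigma}(x,y)=x^{\sigma^2+1}+\alpha x^{\sigma^2}y+(1+\alpha^\sigma)xy^{\sigma^2}+\alpha y^{\sigma^2+1}.$$ Exponent notation: $x^\sigma=\sigma(x)=x^{2^k}$, $x^{\sigma+1}=\sigma(x)\,x$, $x^{\sigma^2}=\sigma(\sigma(x))$, $x^{\sigma^2+1}=\sigma(\sigma(x))\,x$. It is known that $F_{\alpha,\sigma}$ is APN whenever $X^{\sigma+1}+X+\alpha$ has no root in $K$ (a function $F$ on an $\mathbb{F}_2$-vector space $V$ is APN if for all $a\neq 0$ and all $b$ the equation $F(x+a)+F(x)=b$ has at most $2$ solutions $x\in V$). A function $F\colon K^2\to K^2$ is called $3$-to-$1$ if $F(v)=0$ holds exactly for $v=0$, and every nonzero element of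 the image of $F$ has precisely $3$ preimages. Put $n=2m$. For $F=(F_1,F_2)\colon K^2\to K^2$ and $a=(a_1,a_2),b=(b_1,b_2)\in K^2$ let $$W_F(b,a)=\sum_{(x,y)\in K^2}(-1)^{\mathrm{Tr}(b_1F_1(x,y)+b_2F_2(x,y)+a_1x+a_2y)}\in\mathbb{Z},$$ where $\mathrm{Tr}\colon K\to\mathbb{F}_2$ is the absolute trace. (This corresponds to $\sum_{x\in\mathbb{F}_{2^n}}(-1)^{\mathrm{Tr}(bF(x)+ax)}$ under identification of $K^2$ with $\mathbb{F}_{2^n}$; the multiset below does not depend on the choice of nondegenerate bilinear form.) The extended Walsh spectrum of $F$ is the multiset of the values $|W_F(b,a)|$ for $b\in K^2\setminus\{0\}$ and $a\in K^2$. $F$ has classical Walsh spectrum if its extended Walsh spectrum consists of the values $0$, $2^{n/2}$, $2^{(n+2)/2}$, occurring precisely $(2^n-1)2^{n-2}$ times, $(2^n-1)2^{n+1}/3$ times and $(2^n-1)2^{n-2}/3$ times, respectively. *)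

(* Defs.v *)
From mathcomp Require Import all_boot all_order all_algebra all_field.

Set Implicit Arguments.
Unset Strict Implicit.
Unset Printing Implicit Defensive.

Import GRing.Theory.
Local Open Scope ring_scope.

Section Definitions.

Variable K : finFieldType.

Definition frob (k : nat) (x : K) : K := x ^+ (2 ^ k).

Definition f_as (alpha : K) (sigma : K -> K) (v : K * K) : K :=
  let: (x, y) := v in
  sigma x * x + x * sigma y + alpha * (sigma y * y).

Definition g_as (alpha : K) (sigma : K -> K) (v : K * K) : K :=
  let: (x, y) := v in
  sigma (sigma x) * x + alpha * sigma (sigma x) * y
  + (1 + sigma alpha) * x * sigma (sigma y)
  + alpha * (sigma (sigma y) * y).

Definition F_as (alpha : K) (sigma : K -> K) (v : K * K) : K * K :=
  (f_as alpha sigma v, g_as alpha sigma v).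

Definition three_to_one (F : K * K -> K * K) : Prop :=
  (forall v, F v = 0 <-> v = 0) /\
  (forall w, w != 0 -> w \in codom F -> #|[set v | F v == w]| = 3%N).

(* The absolute trace when #|K| = 2 ^ m; it takes values in the prime field
   {0, 1} of K (see abs_trace_F2), which justifies the encoding of
   (-1) ^ Tr x in trace_sign. *)
Definition abs_trace (m : nat) (x : K) : K := \sum_(i < m) x ^+ (2 ^ i).

Definition trace_sign (m : nat) (x : K) : int := (-1) ^+ (abs_trace m x != 0).

Definition walsh (m : nat) (F : K * K -> K * K) (b a : K * K) : int :=
  \sum_(v : K * K)
    trace_sign m (b.1 * (F v).1 + b.2 * (F v).2 + a.1 * v.1 + a.2 * v.2).

(* Multisets are represented by sequences up to permutation. *)
Definition ext_walsh_spectrum (m : nat) (F : K * K -> K * K) : seq nat :=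
  [seq `|walsh m F ba.1 ba.2|%N |
    ba : (K * K) * (K * K) in [pred ba | ba.1 != 0]].

(* The divisions by 2 and by 3 are exact since n is even. *)
Definition classical_walsh_spectrum (m : nat) (F : K * K -> K * K) : Prop :=
  let n := (2 * m)%N in
  perm_eq (ext_walsh_spectrum m F)
    (nseq ((2 ^ n - 1) * 2 ^ (n - 2)) 0%N
     ++ nseq ((2 ^ n - 1) * 2 ^ (n + 1) %/ 3) (2 ^ (n %/ 2))%N
     ++ nseq ((2 ^ n - 1) * 2 ^ (n - 2) %/ 3) (2 ^ ((n + 2) %/ 2))%N).

Lemma abs_trace_F2 (m : nat) (x : K) :
  #|K| = (2 ^ m)%N -> abs_trace m x = 0 \/ abs_trace m x = 1.
Proof.
move=> cK; have ch2 := card_finPcharP cK isT.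
have xE : x ^+ (2 ^ m) = x by rewrite -cK expf_card.
have sq : abs_trace m x ^+ 2 = abs_trace m x.
  rewrite -(pFrobenius_autE ch2) rmorph_sum /=.
  under eq_bigr => i _ do rewrite pFrobenius_autE -exprM -expnSr.
  apply: (addrI x); rewrite -[X in X + _ = _](expr1 x).
  rewrite -(big_ord_recl m (fun i : 'I_m.+1 => x ^+ (2 ^ i))) big_ord_recr /=.
  by rewrite xE addrC.
have /eqP : abs_trace m x * (abs_trace m x - 1) = 0.
  by rewrite mulrBr mulr1 -expr2 sq subrr.
by rewrite mulf_eq0 subr_eq0 => /orP[] /eqP; [left | right].
Qed.

End Definitions.

(* Main.v *)
Require Import Defs.
From mathcomp Require Import all_boot all_order all_algebra all_field.
From mathcomp Require Import ring zify.

Set Implicit Arguments.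
Unset Strict Implicit.
Unset Printing Implicit Defensive.

Import GRing.Theory Num.Theory.
Local Open Scope ring_scope.

(** Write [det] for the determinant of two vectors of K^2 and consider the
    sigma-semilinear map phi(x, y) = (alpha y^sigma, x^sigma + y^sigma).  In
    characteristic 2 a direct expansion gives
      F(v) = (det(v, phi v), det(v, phi^2 v)),
    and the hypothesis on X^(sigma+1) + X + alpha says exactly that
    det(v, phi v) <> 0 for v <> 0: no line of K^2 is stable under phi.

    The symmetry of order 3.  Put psi = phi^m.  It is K-linear, because
    sigma^m = 1, and it commutes with phi.  Comparing determinants before and
    after phi shows that its determinant and trace are fixed by sigma, hence lie
    in F_2.  The determinant is 1.  If the trace were 0, then (psi + 1)^2 = 0;
    by the Schur argument [commuting_schur] psi = 1, and then a vector
    sum_i phi^i(c v), nonzero for some c by Artin's independence of the powers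
    of Frobenius, is fixed by phi, contradicting the absence of stable lines.
    So psi^2 = psi + 1 ([psi_quadratic]): the map psi has order 3, no nonzero
    fixed vector, and F o psi = F as det(psi) = 1.

    APN and 3-to-1.  Expand x = s a + t phi(a) in the basis a, phi(a).  If the
    polarization of F vanishes at (x, a), eliminating s gives a relation in t
    which for t <> 0 yields a line stable under phi; hence x is 0 or a
    ([polar_apn]).  If F(u) = F(v) with a = u + v <> 0, then u solves
    F(u + a) = F(u).  As F is APN this equation has two solutions, and psi(a),
    psi^2(a) are two; so u and v lie in one orbit of psi.

    The Walsh spectrum.  This part holds for any quadratic 3-to-1 map F on K^2.
    Let q = 2^(2m) and let R_b be the radical of the form
    v |-> Tr(b . F(v)).  Then W(b, a)^2 is 0 or q #|R_b|, and W(b, 0) = 1 mod 3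
    since nonzero fibres have three elements; in particular
    W(b, 0)^2 = q #|R_b|.  Thus W(b, 0) = (-2)^m w_b with w_b^2 = #|R_b| and
    w_b = 1 mod 3.  Counting the solutions of F(v) = 0 and F(v) = F(v') gives
      sum_(b <> 0) w_b = 0   and   sum_(b <> 0) w_b^2 = 2 (q - 1),
    that is sum_(b <> 0) (w_b + 2) (w_b - 1) = 0.  No integer congruent to 1
    modulo 3 lies strictly between -2 and 1, so every summand is nonnegative
    and w_b is 1 or -2.  The linear relation fixes how often each occurs, and
    Parseval's identity counts the a with W(b, a) <> 0. *)

(** * Characteristic 2, determinants on pairs and powers of Frobenius *)

Section Char2.
Variable K : finFieldType.
Hypothesis ch2 : 2 \in [pchar K].

(** Turns an identity that holds modulo 2 into one over the integers, which a
    ring normalizer can check once the even part c + c is supplied. *)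
Lemma char2_eq (c x y : K) : x = y + (c + c) -> x = y.
Proof. by rewrite (addrr_pchar2 ch2) addr0. Qed.

Lemma pair_addvv (v : K * K) : v + v = 0.
Proof.
by case: v => x y; apply/eqP; rewrite -pair_eqE /= /pair_eq /= !addrr_pchar2 ?eqxx.
Qed.

Lemma pair_oppv (v : K * K) : - v = v.
Proof. by apply/eqP; rewrite eq_sym -addr_eq0 pair_addvv. Qed.

Definition det2 (v w : K * K) : K := v.1 * w.2 - v.2 * w.1.
Definition scal (c : K) (v : K * K) : K * K := (c * v.1, c * v.2).

Lemma det2Dl u v w : det2 (u + v) w = det2 u w + det2 v w.
Proof. rewrite /det2 /=; ring. Qed.
Lemma det2Dr u v w : det2 w (u + v) = det2 w u + det2 w v.
Proof. rewrite /det2 /=; ring. Qed.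
Lemma det2Zl c v w : det2 (scal c v) w = c * det2 v w.
Proof. rewrite /det2 /=; ring. Qed.
Lemma det2Zr c v w : det2 v (scal c w) = c * det2 v w.
Proof. rewrite /det2 /=; ring. Qed.
Lemma det2vv v : det2 v v = 0.
Proof. rewrite /det2 /=; ring. Qed.
Lemma det2C v w : det2 v w = det2 w v.
Proof. by rewrite -[RHS](oppr_pchar2 ch2) /det2; ring. Qed.

Lemma det2_cramer a b v : det2 a b != 0 ->
  v = scal (det2 v b / det2 a b) a + scal (det2 a v / det2 a b) b.
Proof.
move=> D0; case: v a b D0 => [v1 v2] [a1 a2] [b1 b2] D0.
by rewrite /scal /=; congr (_, _) => /=; rewrite /det2 /= in D0 *; field.
Qed.

Lemma frobD k : {morph @frob K k : x y / x + y}.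
Proof. by move=> x y; rewrite /frob exprDn_pchar // pnatX pnatE // ch2. Qed.
Lemma frobM k : {morph @frob K k : x y / x * y}.
Proof. by move=> x y; rewrite /frob exprMn. Qed.
Lemma frob0 k : @frob K k 0 = 0.
Proof. by rewrite /frob expr0n expn_eq0. Qed.
Lemma frob1 k : @frob K k 1 = 1.
Proof. by rewrite /frob expr1n. Qed.
Lemma frobV k x : @frob K k x^-1 = (frob k x)^-1.
Proof. by rewrite /frob exprVn. Qed.
Lemma frob_eq0 k x : (@frob K k x == 0) = (x == 0).
Proof. by rewrite /frob expf_eq0 expn_gt0. Qed.
Lemma frob_iter k i x : iter i (@frob K k) x = x ^+ (2 ^ (k * i)).
Proof.
by elim: i => [|i IH]; rewrite ?muln0 //= IH /frob -exprM -expnD mulnS addnC.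
Qed.
End Char2.

Section FixedField.
Variables (K : finFieldType) (m : nat).
Hypothesis cardK : #|K| = (2 ^ m)%N.

Lemma expf_card_pow i (x : K) : x ^+ (2 ^ (m * i)) = x.
Proof.
by elim: i => [|i IH]; rewrite ?muln0 // mulnS expnD exprM -cardK expf_card.
Qed.

(** The fixed field of x |-> x^(2^k) inside GF(2^m) is GF(2^gcd(k,m)) = GF(2):
    by Bezout a multiple of k is 1 modulo m, so a fixed x also satisfies
    x^2 = x. *)
Lemma frob_fixed k (x : K) : (0 < k)%N -> coprime k m ->
  frob k x = x -> x = 0 \/ x = 1.
Proof.
move=> k0 co fx.
have itx i : x ^+ (2 ^ (k * i)) = x.
  by rewrite -frob_iter; elim: i => //= i ->.
case: (egcdnP m k0) => a b /= e _.
have x2 : x ^+ 2 = x.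
  rewrite -[RHS](itx a) mulnC e (eqP co) expnD exprM mulnC.
  by rewrite expf_card_pow expn1.
have /eqP : x * (x - 1) = 0 by rewrite mulrBr mulr1 -expr2 x2 subrr.
by rewrite mulf_eq0 subr_eq0 => /orP[] /eqP; [left | right].
Qed.

(** Artin independence of the powers of Frobenius: a relation is a polynomial of
    degree at most 2^(m-1) < #|K| vanishing on the whole field. *)
Lemma frob_independent (c : 'I_m -> K) :
  (forall x, \sum_i c i * x ^+ (2 ^ i) = 0) -> forall i, c i = 0.
Proof.
move=> H i0; pose p : {poly K} := \sum_i c i *: 'X^(2 ^ i).
have sp : (size p <= 2 ^ m)%N.
  apply: leq_trans (size_sum _ _ _) _; apply/bigmax_leqP => i _.
  apply: leq_trans (size_scale_leq _ _) _.
  by rewrite size_polyXn ltn_exp2l.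
have p0 : p = 0.
  apply/eqP/negPn/negP => pn0.
  have := max_poly_roots pn0 (rs := enum K) _ (enum_uniq _).
  rewrite -cardE cardK ltnNge sp => /(_ _)/negP; apply => //.
  apply/allP => x _; apply/eqP; rewrite /p horner_sum -[RHS](H x).
  by apply: eq_bigr => i _; rewrite hornerZ hornerXn.
have := coef0 K (2 ^ i0); rewrite -p0 /p coef_sum (bigD1 i0) //= big1.
  by rewrite addr0 coefZ coefXn eqxx mulr1.
move=> i ii0; have /negPf ne : (i0 : nat) != i by rewrite eq_sym.
by rewrite coefZ coefXn eqn_exp2l // ne mulr0.
Qed.
End FixedField.

(** * The semilinear map phi *)

Section Semilinear.
Variables (K : finFieldType) (m k : nat) (alpha : K).
Hypotheses (m_gt0 : (0 < m)%N) (k_gt0 : (0 < k)%N) (co_km : coprime k m).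
Hypothesis cardK : #|K| = (2 ^ m)%N.
Hypothesis no_root : forall x : K, ~~ root ('X^(2 ^ k + 1) + 'X + alpha%:P) x.

Local Notation sigma := (@frob K k).
Let ch2 : 2 \in [pchar K] := card_finPcharP cardK isT.

Definition phi (v : K * K) : K * K := (alpha * sigma v.2, sigma v.1 + sigma v.2).

Lemma phiD v w : phi (v + w) = phi v + phi w.
Proof. rewrite /phi /= !(frobD ch2); congr (_, _) => /=; ring. Qed.

Lemma phiZ c v : phi (scal c v) = scal (sigma c) (phi v).
Proof. rewrite /phi /= !frobM; congr (_, _) => /=; ring. Qed.

(** The key to the whole proof: both components of F are determinants of
    v against iterates of one semilinear map. *)
Lemma F_as_det v :
  F_as alpha sigma v = (det2 v (phi v), det2 v (phi (phi v))).
Proof.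
case: v => x y; rewrite /F_as /f_as /g_as /det2 /phi /=.
rewrite !(frobD ch2) !frobM; congr (_, _).
  by apply: (char2_eq ch2 (c := alpha * sigma y * y)); ring.
apply: (char2_eq ch2 (c := y * alpha * (sigma (sigma x) + sigma (sigma y)))).
ring.
Qed.

Lemma det2_phi v w : det2 (phi v) (phi w) = alpha * sigma (det2 v w).
Proof.
rewrite (det2C ch2 v w) /det2 (oppr_pchar2 ch2 (w.2 * v.1)) /phi /=.
rewrite (frobD ch2) !frobM.
apply: (char2_eq ch2 (c := - alpha * sigma v.1 * sigma w.2)); ring.
Qed.

Lemma no_rootE x : sigma x * x + x + alpha != 0.
Proof.
have := no_root x; by rewrite /root !hornerE addn1 exprSr.
Qed.

Lemma alpha_neq0 : alpha != 0.
Proof. by have := no_rootE 0; rewrite mulr0 !add0r. Qed.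

(** No line is stable under phi: a stable line through (x, y) with y <> 0 has
    slope x / y a root of X^(sigma+1) + X + alpha, while for y = 0 the
    determinant is x^(sigma+1). *)
Lemma det2_phi_neq0 v : v != 0 -> det2 v (phi v) != 0.
Proof.
case: v => x y v0; rewrite /det2 /phi /= (oppr_pchar2 ch2).
have [y0|yn0] := eqVneq y 0.
  rewrite y0 frob0 mul0r !addr0 mulf_eq0 frob_eq0 orbb.
  by apply: contra v0 => /eqP->; rewrite y0.
have := no_rootE (x / y); apply: contra => /eqP e.
have sy0 : sigma y != 0 by rewrite frob_eq0.
have -> : sigma (x / y) * (x / y) + x / y + alpha =
   (x * (sigma x + sigma y) + y * (alpha * sigma y)) / (y * sigma y).
  by rewrite frobM frobV; field; rewrite yn0 sy0.
by rewrite e mul0r.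
Qed.

Lemma phi_eq0 v : phi v = 0 -> v = 0.
Proof.
move=> e; apply/eqP/negPn/negP => /det2_phi_neq0.
by rewrite e /det2 /= !mulr0 subrr eqxx.
Qed.

(** * Linear maps commuting with phi *)

Section Commuting.
Variable T : K * K -> K * K.
Hypotheses (TD : forall v w, T (v + w) = T v + T w)
  (TZ : forall c v, T (scal c v) = scal c (T v))
  (Tphi : forall v, T (phi v) = phi (T v)).

Let e1 : K * K := (1, 0).
Let e2 : K * K := (0, 1).

Lemma lin_coords v : T v = scal v.1 (T e1) + scal v.2 (T e2).
Proof.
rewrite -!TZ -TD; congr T; case: v => x y; congr (_, _) => /=; ring.
Qed.

Definition lin_det : K := det2 (T e1) (T e2).
Definition lin_tr : K := det2 (T e1) e2 + det2 e1 (T e2).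

Lemma lin_detP v w : det2 (T v) (T w) = lin_det * det2 v w.
Proof. rewrite (lin_coords v) (lin_coords w) /lin_det /det2 /scal /=; ring. Qed.

Lemma lin_trP v w : det2 (T v) w + det2 v (T w) = lin_tr * det2 v w.
Proof. rewrite (lin_coords v) (lin_coords w) /lin_tr /det2 /scal /=; ring. Qed.

Lemma cayley_hamilton2 v : T (T v) = scal lin_tr (T v) - scal lin_det v.
Proof.
rewrite [T (T v)]lin_coords (lin_coords v) /lin_tr /lin_det /det2 /scal /=.
congr (_, _) => /=; ring.
Qed.

Lemma det2_e : det2 e1 e2 = 1.
Proof. by rewrite /det2 /= mulr1 mulr0 subr0. Qed.

(** Both sides of [lin_detP] can be moved through phi, which multiplies
    determinants by alpha after applying sigma; the common nonzero factor
    alpha cancels.  The trace is treated in the same way. *)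
Lemma lin_det_fixed : sigma lin_det = lin_det.
Proof.
have := lin_detP (phi e1) (phi e2); rewrite !Tphi !det2_phi lin_detP frobM det2_e.
by rewrite frob1 !mulr1 [RHS]mulrC => /(mulfI alpha_neq0).
Qed.

Lemma lin_tr_fixed : sigma lin_tr = lin_tr.
Proof.
have := lin_trP (phi e1) (phi e2); rewrite !Tphi !det2_phi -mulrDr -(frobD ch2) lin_trP.
by rewrite frobM det2_e frob1 !mulr1 [RHS]mulrC => /(mulfI alpha_neq0).
Qed.

(** Schur's lemma: the kernel of T is stable under phi, and a nonzero w in it
    makes w, phi(w) a basis of K^2. *)
Lemma commuting_schur w : w != 0 -> T w = 0 -> forall v, T v = 0.
Proof.
move=> w0 Tw v; have D0 := det2_phi_neq0 w0.
have Tpw : T (phi w) = 0.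
  by rewrite Tphi Tw /phi /= frob0 mulr0 addr0.
rewrite (det2_cramer v D0) TD !TZ Tw Tpw /scal /= !mulr0; congr (_, _); exact: addr0.
Qed.
End Commuting.

(** * The automorphism of order 3 *)

Definition psi := iter m phi.

Lemma iter_phiD i v w : iter i phi (v + w) = iter i phi v + iter i phi w.
Proof. by elim: i => //= i ->; rewrite phiD. Qed.

Lemma iter_phiZ i c v :
  iter i phi (scal c v) = scal (c ^+ (2 ^ (k * i))) (iter i phi v).
Proof.
rewrite -frob_iter; elim: i => //= i ->; exact: phiZ.
Qed.

Lemma psiD v w : psi (v + w) = psi v + psi w.
Proof. exact: iter_phiD. Qed.
Lemma psiZ c v : psi (scal c v) = scal c (psi v).
Proof. by rewrite /psi iter_phiZ mulnC (expf_card_pow cardK). Qed.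
Lemma psi_phi v : psi (phi v) = phi (psi v).
Proof. by rewrite /psi -iterSr. Qed.

Lemma psi_eq0 v : psi v = 0 -> v = 0.
Proof. by rewrite /psi; elim: m => //= i IH /phi_eq0. Qed.

Lemma psi_det v w : det2 (psi v) (psi w) = det2 v w.
Proof.
have p1 : lin_det psi != 0.
  apply/eqP => d0.
  have n0 : psi (1, 0) != 0.
    by apply/eqP => /psi_eq0 [] /eqP; rewrite oner_eq0.
  have := det2_phi_neq0 n0; rewrite -psi_phi (lin_detP psiD psiZ) d0 mul0r.
  by rewrite eqxx.
rewrite (lin_detP psiD psiZ).
case: (frob_fixed cardK k_gt0 co_km (lin_det_fixed psiD psiZ psi_phi)) => e.
  by rewrite e eqxx in p1.
by rewrite e mul1r.
Qed.

(** Hilbert 90 for semilinear maps: if phi^m = 1, then phi descends K^2 to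
    GF(2), and for some c the trace sum_i phi^i(c v) is a nonzero vector fixed
    by phi; the line it spans is stable. *)
Lemma psi_neq_id : ~ (forall v, psi v = v).
Proof.
move=> id.
have sum0 c : \sum_(i < m) iter i phi (scal c (1, 0)) = 0.
  set u := \sum_(i < m) _.
  have fu : phi u = u.
    have phi_sum (f : 'I_m -> K * K) : phi (\sum_i f i) = \sum_i phi (f i).
      apply: (big_morph phi phiD); by rewrite /phi /= frob0 mulr0 addr0.
    rewrite /u phi_sum.
    apply: (addrI (scal c (1, 0))).
    rewrite -(big_ord_recl m (fun i : 'I_m.+1 => iter i phi (scal c (1,0)))).
    by rewrite big_ord_recr /= -/psi id addrC.
  apply/eqP/negPn/negP => /det2_phi_neq0; by rewrite fu det2vv eqxx.
(* Since k is prime to m, sigma^i runs over all powers of Frobenius: h records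
   which exponent sigma^i has. *)
pose h (i : 'I_m) : 'I_m := Ordinal (ltn_pmod (k * i) m_gt0).
have hinj : injective h.
  move=> i j /(congr1 val) /= /eqP e; apply/val_inj => /=.
  wlog le : i j e / (i <= j)%N.
    by move=> W; case/orP: (leq_total i j) => ?; [|symmetry];
       apply: W => //; rewrite eq_sym.
  move: e; rewrite eq_sym eqn_mod_dvd ?leq_mul2l ?le ?orbT // -mulnBr.
  rewrite Gauss_dvdr 1?coprime_sym // => d; apply/eqP.
  rewrite eqn_leq le -subn_eq0 -leqn0 leqNgt; apply/negP => p.
  have := dvdn_leq p d; rewrite leqNgt => /negP; apply.
  by apply: leq_ltn_trans (leq_subr _ _) (ltn_ord j).
have [h' hK h'K] := injF_bij hinj.
pose c j := (iter (h' j) phi (1, 0)).1.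
have c0 : forall j, c j = 0.
  apply: (frob_independent cardK) => x.
  rewrite (reindex h) /=; last by exists h' => ? _; rewrite ?hK ?h'K.
  apply: etrans (congr1 fst (sum0 x)); rewrite (raddf_sum (@fst K K)) /=.
  apply: eq_bigr => i _; rewrite iter_phiZ /c hK /= mulrC; congr (_ * _).
  rewrite {2}(divn_eq (k * i) m) expnD [(_ * m)%N]mulnC exprM.
  by rewrite (expf_card_pow cardK).
pose o0 : 'I_m := Ordinal m_gt0.
have := c0 (h o0); rewrite /c hK /= => /eqP; by rewrite oner_eq0.
Qed.

(** Cayley-Hamilton with determinant 1 and trace 1.  Trace 0 would make
    psi + 1 square to zero, hence be non-injective, hence vanish, against
    [psi_neq_id]. *)
Lemma psi_quadratic v : psi (psi v) = psi v + v.
Proof.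
have d1 : lin_det psi = 1 by rewrite /lin_det psi_det det2_e.
rewrite (cayley_hamilton2 psiD psiZ) d1.
have s1 u : scal 1 u = u by case: u => x y; rewrite /scal /= !mul1r.
rewrite s1 (pair_oppv ch2).
case: (frob_fixed cardK k_gt0 co_km (lin_tr_fixed psiD psiZ psi_phi)) => e;
  last by rewrite e s1.
exfalso; apply: psi_neq_id.
have p2 u : psi (psi u) = u.
  by rewrite (cayley_hamilton2 psiD psiZ) d1 e s1 (pair_oppv ch2) /scal !mul0r add0r.
pose S v := psi v + v.
have SD a b : S (a + b) = S a + S b by rewrite /S psiD addrACA.
have SZ c a : S (scal c a) = scal c (S a).
  rewrite /S psiZ; congr (_, _) => /=; by rewrite mulrDr.
have Sp a : S (phi a) = phi (S a) by rewrite /S psi_phi phiD.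
have SS a : S (S a) = 0 by rewrite /S psiD p2 [psi a + a]addrC (pair_addvv ch2).
have S0 a : S a = 0.
  have [//|n0] := eqVneq (S a) 0.
  exact: (commuting_schur SD SZ Sp n0 (SS a)).
by move=> a; have /eqP := S0 a; rewrite /S addr_eq0 (pair_oppv ch2) => /eqP.
Qed.

Lemma F_as_psi v : F_as alpha sigma (psi v) = F_as alpha sigma v.
Proof. by rewrite !F_as_det -!psi_phi !psi_det. Qed.

(** * The APN property and the fibres of F *)

Definition polar (u v : K * K) : K * K :=
  (det2 u (phi v) + det2 v (phi u),
   det2 u (phi (phi v)) + det2 v (phi (phi u))).

Lemma F_asD u v :
  F_as alpha sigma (u + v) = F_as alpha sigma u + F_as alpha sigma v + polar u v.
Proof.
rewrite !F_as_det /polar !phiD !det2Dl !det2Dr.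
congr (_, _) => /=; ring.
Qed.
Lemma polarDr u v w : polar u (v + w) = polar u v + polar u w.
Proof.
rewrite /polar !phiD !det2Dl !det2Dr; congr (_, _) => /=; ring.
Qed.
Lemma polarC u v : polar u v = polar v u.
Proof. by rewrite /polar addrC [X in (_, X)]addrC. Qed.

(** APN property.  With phi^2(a) = p a + q phi(a), the absence of stable lines
    says that l^(sigma+1) + q l + p has no zero l.  For x = s a + t phi(a) the
    two components of the polarization, after eliminating s, leave
    p t + q^2 t^sigma + p^sigma t^(sigma^2) = 0; if t <> 0, then
    z = p t^sigma / t satisfies z^(sigma+1) + q^2 z + p^2 = 0, and the square
    root of z is a forbidden zero. *)
Lemma polar_apn (a x : K * K) : a != 0 -> polar x a = 0 -> x = 0 \/ x = a.
Proof.
move=> a0 P; have D0 := det2_phi_neq0 a0.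
set b := phi a in D0; set D := det2 a b in D0.
have Dba : det2 b a = D by rewrite det2C.
have [p [q pq]] : exists p q, phi b = scal p a + scal q b.
  by eexists; eexists; exact: (det2_cramer (phi b) D0).
have [s [t st]] : exists s t, x = scal s a + scal t b.
  by eexists; eexists; exact: (det2_cramer x D0).
have pb : phi (phi b) = scal (sigma p) b + scal (sigma q) (phi b).
  by rewrite pq phiD !phiZ -pq.
have px : phi x = scal (sigma s) b + scal (sigma t) (phi b).
  by rewrite st phiD !phiZ.
have ppx : phi (phi x) =
    scal (sigma (sigma s)) (phi b) + scal (sigma (sigma t)) (phi (phi b)).
  by rewrite px phiD !phiZ.
case: P; rewrite -/b ppx pb px pq st.
rewrite !(det2Dl, det2Dr, det2Zl, det2Zr, det2vv, Dba) -/D => P1 P2.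
have noev l : sigma l * l + q * l + p != 0.
  set w := scal l a + b.
  have w0 : w != 0.
    apply: contraNneq D0 => w0; rewrite -/D.
    have <- : det2 a w = D by rewrite det2Dr det2Zr det2vv mulr0 add0r.
    by rewrite w0 /det2 /= !mulr0 subrr.
  have := det2_phi_neq0 w0; apply: contra => /eqP e.
  rewrite /w phiD phiZ -/b pq !(det2Dl, det2Dr, det2Zl, det2Zr, det2vv, Dba) -/D.
  by apply/eqP; rewrite -[RHS](mulr0 D) -[X in _ = D * X]e; ring.
(* Up to the factor D = det(a, phi a), E1 is the first component of the
   polarization, and E2 is the image of E1 under sigma; adding q times each of
   them to the second component removes s in characteristic 2. *)
have E1 : s + sigma s + sigma t * q = 0.
  by apply: (mulfI D0); rewrite -/D mulr0 -P1; ring.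
have E2 : sigma s + sigma (sigma s) + sigma (sigma t) * sigma q = 0.
  by rewrite -[RHS](frob0 K k) -E1 !(frobD ch2) frobM.
have E3 : p * t + q ^+ 2 * sigma t + sigma p * sigma (sigma t) = 0.
  have E12 : (s + sigma s + sigma t * q)
    + (sigma s + sigma (sigma s) + sigma (sigma t) * sigma q) = 0.
    by rewrite E1 E2 addr0.
  apply: (mulfI D0); rewrite -/D mulr0 -[RHS](addr0 0) -[X in _ = X + _]P2.
  rewrite -[X in _ = _ + X](mulr0 (q * D)) -[X in _ = _ + _ * X]E12.
  apply: (char2_eq ch2
    (c := - q * D * (s + sigma s + sigma (sigma s) + sigma (sigma t) * sigma q))).
  ring.
have [t0|tn0] := eqVneq t 0.
  move: E1; rewrite t0 frob0 mul0r addr0 => /eqP.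
  rewrite addr_eq0 (oppr_pchar2 ch2) => /eqP/esym fs.
  have -> : scal 0 b = 0 by rewrite /scal !mul0r.
  by case: (frob_fixed cardK k_gt0 co_km fs) => ->; [left|right];
    rewrite addr0 /scal ?mul0r ?mul1r //; case: (a).
exfalso; pose z := p * sigma t / t; pose l := z ^+ (2 ^ m.-1).
have l2 : l ^+ 2 = z.
  by rewrite /l -exprM -expnSr prednK // -cardK expf_card.
have st0 : sigma t != 0 by rewrite frob_eq0.
suff /eqP : (sigma l * l + q * l + p) ^+ 2 = 0.
  by rewrite expf_eq0 /= (negbTE (noev l)).
have frob2 (y y' : K) : (y + y') ^+ 2 = y ^+ 2 + y' ^+ 2.
  exact: (frobD ch2 1 y y').
have sl2 : sigma l ^+ 2 = sigma z.
  by rewrite -l2 /frob exprAC.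
rewrite !frob2 !exprMn sl2 l2 /z !frobM frobV.
rewrite -[RHS](mulr0 (p / t)) -E3; field.
by rewrite tn0 st0.
Qed.

(** If u and u + a have the same image, then so do psi(a) and
    psi(a) + a = psi^2(a), which gives two solutions of one equation
    polar x a = F a.  The APN property leaves u = psi(a) or u = psi^2(a). *)
Lemma F_as_fiber u v :
  F_as alpha sigma v = F_as alpha sigma u ->
  [\/ v = u, v = psi u | v = psi (psi u)].
Proof.
move=> e; have [->|vu] := eqVneq v u; first by constructor 1.
have [a ea] : {a | a = u + v} by exists (u + v).
have a0 : a != 0 by rewrite ea addr_eq0 (pair_oppv ch2) eq_sym.
have va : v = u + a by rewrite ea addrA (pair_addvv ch2) add0r.
have key x : F_as alpha sigma (x + a) = F_as alpha sigma x ->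
    polar x a = F_as alpha sigma a.
  rewrite F_asD -addrA -[RHS]addr0 => /addrI /eqP.
  by rewrite addrC addr_eq0 (pair_oppv ch2) => /eqP.
have k1 : polar u a = F_as alpha sigma a by apply: key; rewrite -va.
have k2 : polar (psi a) a = F_as alpha sigma a.
  by apply: key; rewrite -psi_quadratic !F_as_psi.
have : polar (u + psi a) a = 0.
  by rewrite polarC polarDr ![polar a _]polarC k1 k2 (pair_addvv ch2).
case/(polar_apn a0) => /eqP.
  rewrite addr_eq0 (pair_oppv ch2) => /eqP ua.
  by constructor 2; rewrite va ua psi_quadratic.
rewrite -[psi a](pair_oppv ch2) subr_eq addrC => /eqP ua.
have pua : psi u = a.
  by rewrite ua psiD psi_quadratic addrAC (pair_addvv ch2) add0r.
by constructor 3; rewrite va pua {1}ua -addrA (pair_addvv ch2) addr0.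
Qed.

Lemma F_as_three_to_one : three_to_one (F_as alpha sigma).
Proof.
split=> [v|w w0 /codomP[u eu]].
  split=> [|->]; last first.
    by rewrite F_as_det /det2 /= !mul0r subrr.
  rewrite F_as_det => /(congr1 fst) /= e; apply/eqP/negPn/negP.
  by move=> /det2_phi_neq0; rewrite e eqxx.
have u0 : u != 0.
  by apply: contra w0 => /eqP u0; rewrite eu u0 F_as_det /det2 /= !mul0r subrr.
have pu0 : psi u != 0 by apply: contra u0 => /eqP/psi_eq0->.
have pu v : v != 0 -> psi v != v.
  apply: contra => /eqP e; apply/eqP; have := psi_quadratic v.
  by rewrite e e (pair_addvv ch2).
have -> : [set v | F_as alpha sigma v == w] = [set u; psi u; psi (psi u)].
  apply/setP => v; rewrite !inE eu; apply/eqP/idP => [/F_as_fiber[]->|].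
  - by rewrite eqxx.
  - by rewrite eqxx orbT.
  - by rewrite eqxx !orbT.
  by case/orP => [/orP[]|] /eqP->; rewrite ?F_as_psi.
rewrite setUC cardsU1 cards2 !inE [u == psi u]eq_sym (negbTE (pu u u0)).
rewrite (negbTE (pu _ pu0)) orbF psi_quadratic addrC.
by rewrite -subr_eq0 addrAC subrr add0r (negbTE pu0).
Qed.

End Semilinear.

(** * Characters of K^2 *)

(** Translating the sum by u multiplies it by e u, so a value e u <> 1
    annihilates it. *)
Lemma sum_sign_morph (U : finZmodType) (A : {set U * U}) (e : U * U -> int) :
  (forall u v, u \in A -> v \in A -> u - v \in A) ->
  {in A &, forall u v, e (u + v) = e u * e v} ->
  \sum_(v in A) e v = 0 \/ {in A, forall v, e v = 1}.
Proof.
move=> AB eM.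
have [/forall_inP H|/forall_inPn[u uA ne1]] := boolP [forall v in A, e v == 1].
  by right=> v /H/eqP.
left; set s := \sum_(v in A) e v.
have A0 : 0 \in A by rewrite -(subrr u) AB.
have AN v : v \in A -> - v \in A by move=> vA; rewrite -sub0r AB.
have AD v w : v \in A -> w \in A -> v + w \in A.
  by move=> vA wA; rewrite -[w]opprK AB ?AN.
have es : e u * s = s.
  rewrite [RHS](reindex_inj (addrI u)) /s mulr_sumr.
  rewrite [LHS](eq_bigr (fun v => e (u + v))) => [|v vA]; last by rewrite eM.
  apply: eq_bigl => v; apply/idP/idP => [/(AD _ _ uA)//|uvA].
  by rewrite -(addrK u v) [v + u]addrC AB.
have /eqP : (e u - 1) * s = 0 by rewrite mulrBl mul1r es subrr.
by rewrite mulf_eq0 subr_eq0 (negbTE ne1) => /eqP.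
Qed.

Section Walsh.
Variables (K : finFieldType) (m : nat) (F : K * K -> K * K).
Hypotheses (m_gt0 : (0 < m)%N) (cardK : #|K| = (2 ^ m)%N).
Let ch2 : 2 \in [pchar K] := card_finPcharP cardK isT.
Let q : nat := (2 ^ (2 * m))%N.

Let cardV : #|{: K * K}| = q.
Proof. by rewrite card_prod cardK /q mul2n -addnn expnD. Qed.

Let q_gt0 : (0 < q)%N. Proof. by rewrite expn_gt0. Qed.

Let card_neq0 : #|[pred v : K * K | v != 0]| = q.-1.
Proof. by rewrite -cardV -(cardC1 (0 : K * K)); apply: eq_card => v; rewrite !inE. Qed.

Local Notation chi := (trace_sign m).
Definition dot (a v : K * K) : K := a.1 * v.1 + a.2 * v.2.

Lemma dotDl a b v : dot (a + b) v = dot a v + dot b v.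
Proof. rewrite /dot /=; ring. Qed.
Lemma dotDr a v w : dot a (v + w) = dot a v + dot a w.
Proof. rewrite /dot /=; ring. Qed.
Lemma dot0l v : dot 0 v = 0.
Proof. by rewrite /dot /= !mul0r addr0. Qed.
Lemma dot0r v : dot v 0 = 0.
Proof. by rewrite /dot /= !mulr0 addr0. Qed.

Lemma abs_traceD x y : abs_trace m (x + y : K) = abs_trace m x + abs_trace m y.
Proof.
rewrite /abs_trace -big_split /=; apply: eq_bigr => i _.
exact: (frobD ch2 i).
Qed.

Lemma chiD (x y : K) : chi (x + y) = chi x * chi y.
Proof.
rewrite /trace_sign abs_traceD.
case: (abs_trace_F2 x cardK) => ->; case: (abs_trace_F2 y cardK) => ->;
  by rewrite ?add0r ?addr0 ?(addrr_pchar2 ch2) ?eqxx ?oner_eq0.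
Qed.
Lemma chi0 : chi (0 : K) = 1.
Proof.
by rewrite /trace_sign /abs_trace big1 ?eqxx // => i _; rewrite expr0n expn_eq0.
Qed.
Lemma chi_sqr (x : K) : chi x * chi x = 1.
Proof. by rewrite -chiD (addrr_pchar2 ch2) chi0. Qed.

(** The absolute trace is a nontrivial combination of powers of Frobenius. *)
Lemma chi_nontrivial : exists x : K, chi x != 1.
Proof.
have [/existsP//|] := boolP [exists x : K, chi x != 1].
rewrite negb_exists => /forallP H.
have tr0 (x : K) : \sum_(i < m) 1 * x ^+ (2 ^ i) = 0.
  under eq_bigr => i _ do rewrite mul1r.
  apply/eqP/negPn/negP => tx; move: (H x).
  by rewrite /trace_sign /abs_trace tx.
by have /eqP := frob_independent cardK tr0 (Ordinal m_gt0); rewrite oner_eq0.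
Qed.

Lemma sum_chi_dot v : \sum_a chi (dot a v) = q%:R * (v == 0)%:R.
Proof.
have [->|v0] := eqVneq v 0.
  rewrite mulr1 (eq_bigr (fun=> 1)) => [|a _]; last by rewrite dot0r chi0.
  by rewrite sumr_const cardV.
rewrite mulr0.
case: (@sum_sign_morph K setT (fun a : K * K => chi (dot a v))).
- by move=> *; rewrite inE.
- by move=> a b _ _; rewrite dotDl chiD.
- by move=> H; rewrite -[RHS]H; apply: eq_bigl => a; rewrite inE.
move=> H; have [x /negP[]] := chi_nontrivial; apply/eqP.
case: v v0 H => v1 v2 v0 H.
have [v10|v10] := eqVneq v1 0.
  have v20 : v2 != 0 by apply: contra v0 => /eqP->; rewrite v10.
  by rewrite -(H (0, x / v2)) ?inE // /dot /= mul0r add0r divfK.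
by rewrite -(H (x / v1, 0)) ?inE // /dot /= mul0r addr0 divfK.
Qed.

Lemma walshE b a : walsh m F b a = \sum_v chi (dot b (F v) + dot a v).
Proof. by apply: eq_bigr => v _; rewrite /dot !addrA. Qed.

(** * Walsh sums of a 3-to-1 map *)

Hypothesis F3 : three_to_one F.

Lemma F_eq0 v : (F v == 0) = (v == 0).
Proof. by apply/eqP/eqP => /(F3.1 v). Qed.

Lemma fiber_card v : #|[set w | F w == F v]| = if v == 0 then 1%N else 3%N.
Proof.
have [->|v0] := eqVneq v 0.
  have /eqP-> : F 0 == 0 by rewrite F_eq0.
  rewrite -(cards1 (0 : K * K)); apply: eq_card => w; by rewrite !inE F_eq0.
by apply: F3.2; rewrite ?F_eq0 // codom_f.
Qed.

(** By orthogonality of characters this sum counts the zeros of F. *)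
Lemma sum_walsh0 : \sum_b walsh m F b 0 = q%:R.
Proof.
under eq_bigr => b _ do rewrite walshE.
rewrite exchange_big /= (bigD1 (0 : K * K)) //= [X in _ + X]big1 => [|v v0].
  under eq_bigr => b _ do rewrite dot0l addr0.
  by rewrite sum_chi_dot F_eq0 eqxx mulr1 addr0.
under eq_bigr => b _ do rewrite dot0l addr0.
by rewrite sum_chi_dot F_eq0 (negbTE v0) mulr0.
Qed.

(** By orthogonality of characters this sum counts the pairs (v, w) with
    F v = F w: one for v = 0 and three for each of the q - 1 other v. *)
Lemma sum_walsh0_sqr : \sum_b walsh m F b 0 ^+ 2 = q%:R * (3 * q%:R - 2).
Proof.
have -> : \sum_b walsh m F b 0 ^+ 2 =
   \sum_v \sum_w \sum_b chi (dot b (F v + F w)).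
  transitivity (\sum_b \sum_v \sum_w chi (dot b (F v + F w))).
    apply: eq_bigr => b _; rewrite walshE expr2 mulr_suml.
    apply: eq_bigr => v _; rewrite mulr_sumr; apply: eq_bigr => w _.
    by rewrite !dot0l !addr0 dotDr chiD.
  rewrite exchange_big; apply: eq_bigr => v _; exact: exchange_big.
transitivity (\sum_v q%:R * #|[set w | F w == F v]|%:R : int).
  apply: eq_bigr => v _.
  under eq_bigr => w _ do rewrite sum_chi_dot.
  rewrite -mulr_sumr -sum1dep_card natr_sum [in RHS]big_mkcond /=.
  congr (_ * _); apply: eq_bigr => w _.
  by rewrite addr_eq0 (pair_oppv ch2) eq_sym; case: eqP.
rewrite -mulr_sumr; congr (_ * _); rewrite (bigD1 (0 : K * K)) //= fiber_card eqxx.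
rewrite (eq_bigr (fun=> 3)) => [|v v0]; last by rewrite fiber_card (negbTE v0).
rewrite sumr_const card_neq0 -mulr_natr; have := q_gt0; lia.
Qed.

(** Group the sum by the values of F: zero is taken once, every other value
    three times. *)
Lemma walsh0_mod3 b : exists z : int, walsh m F b 0 = 1 + 3 * z.
Proof.
exists (\sum_(w : K * K | (w != 0) && (w \in codom F)) chi (dot b w)).
rewrite walshE (partition_big F predT) //= (bigD1 (0 : K * K)) //=; congr (_ + _).
  rewrite (eq_bigl (pred1 0)) => [|v]; last by rewrite F_eq0.
  by rewrite big_pred1_eq (eqP (_ : F 0 == 0)) ?F_eq0 // !dot0r addr0 chi0.
rewrite (bigID (fun w => w \in codom F)) /= [X in _ + X]big1 ?addr0 => [|w /andP[_ nw]].
  rewrite mulr_sumr; apply: eq_bigr => w /andP[w0 wF].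
  rewrite (eq_bigr (fun=> chi (dot b w))) => [|v /eqP->]; last first.
    by rewrite dot0l addr0.
  rewrite sumr_const -cardsE F3.2 //; ring.
by rewrite big_pred0 // => v; apply: contraNF nw => /eqP<-; exact: codom_f.
Qed.

(** * Radicals and squares of Walsh values of a quadratic map *)

Definition deriv2 u v := F (u + v) + F u + F v.
Hypothesis quad : forall u v w, deriv2 u (v + w) = deriv2 u v + deriv2 u w.

Definition radical b := [set u | [forall v, chi (dot b (deriv2 u v)) == 1]].

Lemma deriv2C u v : deriv2 u v = deriv2 v u.
Proof. by rewrite /deriv2 [u + v]addrC addrAC. Qed.

Lemma sum_radical b u :
  \sum_v chi (dot b (deriv2 u v)) = q%:R * (u \in radical b)%:R.
Proof.
rewrite inE; have [/forallP H|/forallPn[v nv]] :=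
  boolP [forall v, chi (dot b (deriv2 u v)) == 1].
  rewrite (eq_bigr (fun=> 1)) => [|v _]; last exact/eqP.
  by rewrite sumr_const cardV mulr1.
rewrite mulr0.
case: (@sum_sign_morph K setT (fun v => chi (dot b (deriv2 u v)))).
- by move=> *; rewrite inE.
- by move=> v1 v2 _ _; rewrite quad dotDr chiD.
- by move=> H; rewrite -[RHS]H; apply: eq_bigl => a; rewrite inE.
by move=> H; rewrite H ?inE ?eqxx in nv.
Qed.

(** Substituting w = v + u in the double sum over v and w, the inner sum over v
    is that of the additive character attached to u by the polarization, which
    vanishes unless u is in the radical. *)
Lemma walsh_sqr b a :
  walsh m F b a ^+ 2 = q%:R * \sum_(u in radical b) chi (dot b (F u) + dot a u).
Proof.
pose g v := chi (dot b (F v) + dot a v).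
have gD v u : g v * g (v + u) = g u * chi (dot b (deriv2 u v)).
  have e : dot b (F (v + u)) + dot a (v + u) =
     (dot b (F v) + dot a v) + ((dot b (F u) + dot a u) + dot b (deriv2 u v)).
    rewrite /deriv2 [u + v]addrC !dotDr.
    apply: (char2_eq ch2 (c := - dot b (F v) - dot b (F u))); ring.
  rewrite /g e; move: (dot b (F v) + dot a v) (dot b (F u) + dot a u) => A B.
  by rewrite !chiD !mulrA chi_sqr mul1r.
rewrite walshE -/g expr2 mulr_suml.
transitivity (\sum_v \sum_u g u * chi (dot b (deriv2 u v))).
  apply: eq_bigr => v _; rewrite mulr_sumr (reindex_inj (addrI v)) /=.
  by apply: eq_bigr => u _; rewrite gD.
rewrite exchange_big mulr_sumr [RHS]big_mkcond /=; apply: eq_bigr => u _.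
rewrite -mulr_sumr sum_radical; case: (u \in _); rewrite ?mulr0 //= mulr1 mulrC //.
Qed.

Lemma radical0 b : 0 \in radical b.
Proof.
rewrite inE; apply/forallP => v; apply/eqP.
have -> : deriv2 0 v = 0.
  by apply: (addrI (deriv2 v 0)); rewrite [deriv2 0 v]deriv2C -quad !addr0.
by rewrite dot0r chi0.
Qed.

Lemma radicalB b u v : u \in radical b -> v \in radical b -> u - v \in radical b.
Proof.
rewrite !inE (pair_oppv ch2) => /forallP Hu /forallP Hv; apply/forallP => w.
by rewrite deriv2C quad dotDr chiD ![deriv2 w _]deriv2C (eqP (Hu w)) (eqP (Hv w)).
Qed.

(** On the radical the quadratic form is additive, so the sum in [walsh_sqr] is
    that of a character of the group radical b. *)
Lemma walsh_sqr_cases b a :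
  walsh m F b a ^+ 2 = 0 \/ walsh m F b a ^+ 2 = q%:R * #|radical b|%:R.
Proof.
rewrite walsh_sqr.
case: (@sum_sign_morph K (radical b) (fun u => chi (dot b (F u) + dot a u))).
- exact: radicalB.
- move=> u v; rewrite [v \in _]inE => _ /forallP/(_ u)/eqP cv.
  have e : F (u + v) = F u + F v + deriv2 v u.
    rewrite /deriv2 [v + u]addrC -[_ + F v + F u]addrA [F v + F u]addrC.
    by rewrite [RHS]addrCA (pair_addvv ch2) addr0.
  have {}e : dot b (F (u + v)) + dot a (u + v) = (dot b (F u) + dot a u) +
      (dot b (F v) + dot a v) + dot b (deriv2 v u).
    by rewrite e dotDr dotDr (dotDr a); ring.
  by rewrite e chiD cv mulr1 chiD.
- by move=> ->; left; rewrite mulr0.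
move=> H; right; rewrite (eq_bigr (fun=> 1)) => [|u /H//].
by rewrite sumr_const.
Qed.

(** Parseval's identity: summing [walsh_sqr] over a keeps only u = 0. *)
Lemma sum_walsh_sqr b : \sum_a walsh m F b a ^+ 2 = q%:R ^+ 2.
Proof.
under eq_bigr => a _ do rewrite walsh_sqr.
rewrite -mulr_sumr exchange_big /= expr2; congr (_ * _).
rewrite (bigD1 (0 : K * K)) ?radical0 //= [X in _ + X]big1 ?addr0 => [|u /andP[_ u0]].
  under eq_bigr => a _ do rewrite chiD.
  rewrite -mulr_sumr sum_chi_dot eqxx mulr1.
  by rewrite (eqP (_ : F 0 == 0)) ?F_eq0 // dot0r chi0 mul1r.
under eq_bigr => a _ do rewrite chiD.
by rewrite -mulr_sumr sum_chi_dot (negbTE u0) !mulr0.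
Qed.

Lemma walsh0_neq0 b : walsh m F b 0 != 0.
Proof. have [z ->] := walsh0_mod3 b; lia. Qed.

Lemma walsh0_sqr b : walsh m F b 0 ^+ 2 = q%:R * #|radical b|%:R.
Proof.
case: (walsh_sqr_cases b 0) => // /eqP.
by rewrite expf_eq0 (negbTE (walsh0_neq0 b)).
Qed.

(** * The normalized values w_b and the spectrum *)

(** The base -2 instead of 2 keeps the normalization congruent to 1 modulo 3. *)
Let p : int := (-2) ^+ m.
Lemma qE : q%:R = p ^+ 2 :> int.
Proof. by rewrite /p exprAC sqrrN -natrX -natrX /q -expnM mulnC. Qed.

Lemma p_mod3 : exists y, p = 1 + 3 * y.
Proof.
rewrite /p; elim: m => [|i [y IH]]; first by exists 0.
by exists (-1 - 2 * y); rewrite exprS IH; ring.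
Qed.

Lemma p_neq0 : p != 0.
Proof. by rewrite expf_neq0. Qed.

Lemma abszp : `|p|%N = (2 ^ m)%N.
Proof. by rewrite /p abszX. Qed.

(** The division is exact ([nwalshE]): the square of the Walsh value is a
    multiple of q = p^2. *)
Definition nwalsh b : int := divz (walsh m F b 0) p.

Lemma nwalshE b : walsh m F b 0 = p * nwalsh b.
Proof.
rewrite /nwalsh mulrC divzK // dvdzE abszp -(@dvdn_pexp2r _ _ 2) // -abszX.
by rewrite walsh0_sqr abszM natz /= -expnM mulnC -/q; apply: dvdn_mulr.
Qed.

Lemma nwalsh_mod3 b : exists z, nwalsh b = 1 + 3 * z.
Proof.
have [z ez] := walsh0_mod3 b; have [y ey] := p_mod3.
exists (z - nwalsh b * y); move: ez; rewrite nwalshE ey; lia.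
Qed.

Lemma nwalsh_sqr b : nwalsh b ^+ 2 = #|radical b|%:R.
Proof.
apply: (mulfI (expf_neq0 2 p_neq0)).
by rewrite -exprMn -nwalshE walsh0_sqr qE.
Qed.

Lemma nwalsh0 : nwalsh 0 = p.
Proof.
apply: (mulfI p_neq0); rewrite -nwalshE -expr2 -qE walshE.
rewrite (eq_bigr (fun=> 1)) => [|v _]; last by rewrite !dot0l addr0 chi0.
by rewrite sumr_const cardV.
Qed.

Lemma sum_nwalsh : \sum_(b : K * K | b != 0) nwalsh b = 0.
Proof.
have e := bigD1 (0 : K * K) (erefl : predT _) (F := nwalsh).
apply: (addrI (nwalsh 0)); rewrite -e addr0.
apply: (mulfI p_neq0); rewrite mulr_sumr nwalsh0 -expr2 -qE -sum_walsh0.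
by apply: eq_bigr => b _; rewrite nwalshE.
Qed.

Lemma sum_nwalsh_sqr : \sum_(b : K * K | b != 0) nwalsh b ^+ 2 = 2 * q%:R - 2.
Proof.
have e := bigD1 (0 : K * K) (erefl : predT _) (F := fun b => nwalsh b ^+ 2).
apply: (addrI (nwalsh 0 ^+ 2)); rewrite -e.
apply: (mulfI (expf_neq0 2 p_neq0)); rewrite mulr_sumr nwalsh0 -qE.
transitivity (q%:R * (3 * q%:R - 2) : int); last ring.
rewrite -sum_walsh0_sqr.
by apply: eq_bigr => b _; rewrite nwalshE exprMn qE.
Qed.

(** The sum of (w + 2) (w - 1) over b <> 0 is zero, and its terms are
    nonnegative because w is congruent to 1 modulo 3. *)
Lemma nwalsh_cases b : b != 0 -> nwalsh b = 1 \/ nwalsh b = -2.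
Proof.
move=> b0.
have ge0 c : c != 0 -> 0 <= (nwalsh c + 2) * (nwalsh c - 1).
  by move=> _; have [z ->] := nwalsh_mod3 c; nia.
have s0 : \sum_(c : K * K | c != 0) (nwalsh c + 2) * (nwalsh c - 1) = 0.
  transitivity (\sum_(c : K * K | c != 0) (nwalsh c ^+ 2 + nwalsh c - 2)).
    by apply: eq_bigr => c _; ring.
  rewrite sumrB big_split /= sum_nwalsh sum_nwalsh_sqr sumr_const card_neq0.
  rewrite -mulr_natr; have := q_gt0; lia.
have /eqP := psumr_eq0P ge0 s0 b0.
rewrite mulf_eq0 subr_eq0 addr_eq0 => /orP[] /eqP; by [right|left].
Qed.

Let N0 := #|[set b : K * K | (b != 0) && (nwalsh b == 1)]|.
Let N1 := #|[set b : K * K | (b != 0) && (nwalsh b != 1)]|.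

Lemma sum_nonzero (R : nmodType) (f : K * K -> R) (x y : R) :
  (forall b, b != 0 -> nwalsh b = 1 -> f b = x) ->
  (forall b, b != 0 -> nwalsh b = -2 -> f b = y) ->
  \sum_(b : K * K | b != 0) f b = x *+ N0 + y *+ N1.
Proof.
move=> fx fy; rewrite (bigID (fun b => nwalsh b == 1)) /=; congr (_ + _).
  rewrite (eq_bigr (fun=> x)) => [|b /andP[b0 /eqP e]]; last exact: fx.
  by rewrite sumr_const /N0 cardsE.
rewrite (eq_bigr (fun=> y)) => [|b /andP[b0 e]].
  by rewrite sumr_const /N1 cardsE.
by apply: fy => //; case: (nwalsh_cases b0) e => // ->.
Qed.

(** The vanishing first moment reads N0 - 2 N1 = 0. *)
Lemma N0E : (N0 = 2 * N1)%N.
Proof.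
have := sum_nonzero (f := nwalsh) (fun _ _ e => e) (fun _ _ e => e).
rewrite sum_nwalsh -[(-2) *+ _]mulr_natr; lia.
Qed.

Lemma N1E : (3 * N1 = q - 1)%N.
Proof.
have := sum_nonzero (f := fun=> 1%N) (fun _ _ _ => erefl) (fun _ _ _ => erefl).
rewrite sum1_card card_neq0.
have natE n : (1%N *+ n = n)%R by elim: n => // n IH; rewrite mulrS IH.
rewrite !natE N0E -[GRing.add _ _]/(_ + _)%N; lia.
Qed.

Lemma abs_walsh b a (s : nat) : #|radical b| = (s ^ 2)%N ->
  `|walsh m F b a|%N = if walsh m F b a == 0 then 0%N else (2 ^ m * s)%N.
Proof.
move=> rs; case: eqP => [->//|/eqP w0].
case: (walsh_sqr_cases b a) => [/eqP|e].
  by rewrite expf_eq0 (negbTE w0).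
apply/eqP; rewrite -(@eqn_exp2r _ _ 2) // -abszX e rs abszM !natz /=.
by rewrite expnMn /q -expnM [(m * 2)%N]mulnC.
Qed.

(** Parseval's identity, in which all nonzero terms equal q #|radical b|. *)
Lemma card_walsh_neq0 b :
  (#|[set a | walsh m F b a != 0]| * #|radical b| = q)%N.
Proof.
have := sum_walsh_sqr b.
rewrite (bigID (fun a => walsh m F b a != 0)) /= [X in _ + X]big1; last first.
  by move=> a /negPn/eqP->.
rewrite (eq_bigr (fun=> q%:R * #|radical b|%:R)); last first.
  move=> a w0; case: (walsh_sqr_cases b a) => // /eqP.
  by rewrite expf_eq0 (negbTE w0).
rewrite addr0 sumr_const -[X in _ *+ X]cardsE -[X in X = _]mulr_natr expr2 -mulrA.
have q0 : q%:R != 0 :> int by rewrite pnatr_eq0 -lt0n.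
move=> /(mulfI q0) /eqP; rewrite -natrM eqr_nat => /eqP <-; exact: mulnC.
Qed.

(** One formula for all x, so that the comparison of multiplicities below
    does not split on the value x. *)
Lemma count_abs_walsh b (s x : nat) : (0 < s)%N -> #|radical b| = (s ^ 2)%N ->
  let z := #|[set a | walsh m F b a != 0]| in
  #|[set a | `|walsh m F b a|%N == x]|
    = ((x == 0) * (q - z) + (x == 2 ^ m * s) * z)%N.
Proof.
move=> s0 rs z; rewrite -sum1dep_card.
rewrite (bigID (fun a => walsh m F b a == 0)) /=; congr (_ + _)%N.
  have -> : (q - z)%N = #|[set a | walsh m F b a == 0]|.
    rewrite /z -cardV -(cardC [set a | walsh m F b a != 0]) addKn.
    by apply: eq_card => a; rewrite !inE negbK.
  rewrite -sum1dep_card; case: (x =P 0%N) => [->|xn].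
    by rewrite mul1n; apply: eq_bigl => a; rewrite absz_eq0 andbb.
  rewrite mul0n big_pred0 // => a; apply/negP => /andP[/eqP e /eqP w].
  by apply: xn; rewrite -e w.
rewrite /z -sum1dep_card; case: (x =P (2 ^ m * s)%N) => [->|xn].
  rewrite mul1n; apply: eq_bigl => a; rewrite (abs_walsh a rs).
  by have [_|_] := eqVneq (walsh m F b a) 0; rewrite ?eqxx ?andbF.
rewrite /= mul0n big_pred0 // => a; apply/negP => /andP[/eqP e /negbTE w].
by apply: xn; rewrite -e (abs_walsh a rs) w.
Qed.

Lemma count_ext_walsh x : count_mem x (ext_walsh_spectrum m F) =
  (\sum_(b : K * K | b != 0%R) #|[set a | `|walsh m F b a|%N == x]|)%N.
Proof.
rewrite -sum1_count /ext_walsh_spectrum /image_mem big_map big_enum_cond /=.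
rewrite [RHS](eq_bigr (fun b => \sum_(a : K * K | `|walsh m F b a|%N == x) 1%N)%N).
  by rewrite pair_big_dep /=; apply: eq_big => -[].
by move=> b _; rewrite sum1dep_card.
Qed.

Theorem quadratic_three_to_one_classical : classical_walsh_spectrum m F.
Proof.
rewrite /classical_walsh_spectrum /=; apply/allP => x _; apply/eqP.
rewrite count_ext_walsh !count_cat !count_nseq /=.
set Q := (2 ^ (2 * m - 2))%N.
have qQ : q = (4 * Q)%N by rewrite /Q -(expnD 2 2) subnKC // (leq_mul2l 2 1).
rewrite (@sum_nonzero nat (fun b => #|[set a | `|walsh m F b a|%N == x]|)
  ((x == 2 ^ m) * q)%N
  (((x == 0) * (3 * Q) + (x == 2 ^ (m + 1)) * Q)%N)); first last.
- move=> b b0 w; have r : #|radical b| = (2 ^ 2)%N.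
    by have := nwalsh_sqr b; rewrite w; lia.
  rewrite (count_abs_walsh _ _ r) //= -expnSr addn1.
  have := card_walsh_neq0 b; rewrite r qQ => e.
  have -> : #|[set a | walsh m F b a != 0]| = Q.
    by apply/eqP; rewrite -(@eqn_pmul2l 4) // -e mulnC.
  by congr (_ * _ + _)%N; lia.
- move=> b b0 w; have r : #|radical b| = (1 ^ 2)%N.
    by have := nwalsh_sqr b; rewrite w; lia.
  rewrite (count_abs_walsh _ _ r) //= muln1.
  by have := card_walsh_neq0 b; rewrite r muln1 => ->; rewrite subnn muln0.
have natE n i : (i *+ n)%R = (n * i)%N by elim: n => // n IH; rewrite mulrS IH.
have h1 : ((2 * m) %/ 2 = m)%N by rewrite mulKn.
have h2 : ((2 * m + 2) %/ 2 = m + 1)%N by rewrite -{2}[2%N]muln1 -mulnDr mulKn.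
have h3 : (2 ^ (2 * m + 1) = q * 2)%N by rewrite expnD.
rewrite !natE h1 h2 h3 -/q -N1E -!mulnA !mulKn // N0E !(eq_sym _ x).
rewrite -[GRing.add _ _]/(_ + _)%N.
by case: (x == _); case: (x == _); case: (x == _); ring.
Qed.
End Walsh.

Theorem theorem4p3 (m k : nat) (K : finFieldType) (alpha : K)
    (m_gt0 : (0 < m)%N) (k_gt0 : (0 < k)%N) (co_km : coprime k m)
    (cardK : #|K| = (2 ^ m)%N)
    (no_root : forall x : K, ~~ root ('X^(2 ^ k + 1) + 'X + alpha%:P) x) :
  three_to_one (F_as alpha (@frob K k)) /\
  classical_walsh_spectrum m (F_as alpha (@frob K k)).
Proof.
have F3 := F_as_three_to_one m_gt0 k_gt0 co_km cardK no_root.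
split=> //; apply: (quadratic_three_to_one_classical m_gt0 cardK F3) => u v w.
have bilin (a b : K * K) : deriv2 (F_as alpha (@frob K k)) a b = polar k alpha a b.
  have ch2 : 2 \in [pchar K] := card_finPcharP cardK isT.
  rewrite /deriv2 (F_asD k alpha cardK) addrAC -addrA addrAC.
  by rewrite [X in _ + X + _]addrC (pair_addvv ch2) add0r.
by rewrite !bilin (polarDr k alpha cardK).
Qed.
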